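(* For all integers $n\ge m\ge1$ we have \[ \rho\left(\frac{n}{m}\right)\le\nu(n,m)\le\rho\left(\frac{n+1}{m+1}\right). \]
   Context: $\nu(n,m)$ is the probability that a uniformly random permutation $\sigma$ in the symmetric group $\mathcal{S}_n$ on $\{1,\ldots,n\}$ has no cycle of length greater than $m$. $\rho:[0,\infty)\to\mathbb{R}$ is the Dickman function: the unique continuous function satisfying $\rho(u)=1$ for $0\le u\le1$ and $u\rho'(u)=-\rho(u-1)$ for $u>1$. *)

(* Defs.v *)
From mathcomp Require Import all_boot all_order all_algebra all_fingroup.
From mathcomp Require Import all_classical all_reals all_analysis.
Set Implicit Arguments.
Unset Strict Implicit.
Unset Printing Implicit Defensive.
Import Order.TTheory GRing.Theory Num.Theory.
Import numFieldNormedType.Exports.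
Local Open Scope classical_set_scope.
Local Open Scope ring_scope.

(* The set {1, ..., n} is represented by 'I_n = {0, ..., n - 1}; the cycles in
   porbits s include the fixed points, as cycles of length 1. *)
Definition perms_cycles_le (n m : nat) : {set {perm 'I_n}} :=
  [set s : {perm 'I_n} | [forall C in porbits s, (#|C| <= m)%N]]%SET.

Definition nu (R : realType) (n m : nat) : R :=
  #|perms_cycles_le n m|%:R / #|{perm 'I_n}|%:R.

(* The Dickman function has domain [0, +oo[: the values of rho at negative
   arguments are left unconstrained. There is no derivative condition at u = 1,
   where rho has a corner. *)
Definition is_dickman (R : realType) (rho : R -> R) : Prop :=
  [/\ {within `[0, +oo[, continuous rho},
      forall u : R, 0 <= u <= 1 -> rho u = 1
    & forall u : R, 1 < u ->
        derivable rho u 1 /\ u * derive1 rho u = - rho (u - 1)].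

(* Main.v *)
Require Import Defs.
From mathcomp Require Import all_boot all_order all_algebra all_fingroup.
From mathcomp Require Import all_classical all_reals all_analysis.
From mathcomp Require Import ring lra.
From mathcomp Require Import fintype finset.
Import Order.TTheory GRing.Theory Num.Theory.
Import numFieldNormedType.Exports.

(** Both sides satisfy an averaging identity. Classifying the permutations of
    n points by the length j of the cycle of a given point yields, for
    n >= m,
      n nu(n, m) = nu(n - 1, m) + ... + nu(n - m, m)         (nu_recurrence),
    and integrating (u rho(u))' = rho(u) - rho(u - 1) yields, for u >= 1,
      u rho(u) = int_(u - 1)^u rho                        (dickman_integral).
    The function rho is nonnegative and nonincreasing, so a Riemann sum of step
    1/m over [u - 1, u] lies below m u rho(u) when it takes the right endpoints
    and above it when it takes the left endpoints (dickman_sum).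

    Both bounds then follow by strong induction on n; for n <= m every
    quantity is 1. For the lower bound take u = n/m: the left-endpoint sum is
    rho((n - 1)/m) + ... + rho((n - m)/m), which is at least n rho(n/m) and,
    by induction, at most n nu(n, m). For the upper bound take
    u = (n + 1)/(m + 1) and step 1/(m + 1): the right-endpoint sum is at most
    (n + 1) rho(u), its first term is rho(u), and the other m terms
    rho((n + 1 - j)/(m + 1)) bound nu(n - j, m) by induction; cancelling rho(u)
    leaves n nu(n, m) <= n rho(u).

    In the combinatorial part, the permutations are those of a fixed type that
    are supported in a varying subset A. A cycle of x is built up one point at
    a time: multiplying by a transposition (x y) inserts the fixed point y
    after x, leaving the other cycles unchanged (porbit_insert). Hence, if
    c(k) permutations of k points have only short cycles,
    (N - 1) ... (N - j + 1) c(N - j) permutations of N points have a cycle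
    of length j through x and all other cycles short (card_cycle_perms). *)

(** * Counting permutations by the cycle of a point *)

Section Cycles.
Context (T : finType).
Implicit Types (s : {perm T}) (A B : {set T}) (x y z : T).

Lemma porbit_min s z B :
  z \in B -> (forall w, w \in B -> s w \in B) -> porbit s z \subset B.
Proof.
move=> zB sB; apply/subsetP => _ /porbitP[i ->].
elim: i => [|i IH]; first by rewrite expg0 perm1.
by rewrite expgSr permM sB.
Qed.

Lemma porbit_closed s z w : w \in porbit s z -> s w \in porbit s z.
Proof. by move=> /porbitP[i ->]; rewrite -permM -expgSr mem_porbit. Qed.

Lemma porbit_fix s y z : s y = y -> z != y -> y \notin porbit s z.
Proof.
move=> sy; apply: contra; rewrite porbit_sym => /porbitP[i ->].
by elim: i => [|i IH]; rewrite ?expg0 ?perm1 // expgSr permM (eqP IH) sy.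
Qed.

(** The product maps x to y and y to s x, and agrees with s elsewhere: the
    point y is spliced into the cycle of x, right after x. *)
Lemma porbit_insert s x y z : x != y -> s y = y -> z != y ->
  porbit (tperm x y * s)%g z =
    if x \in porbit s z then y |: porbit s z else porbit s z.
Proof.
move=> xy sy zy; set t := (tperm x y * s)%g.
have tx : t x = y by rewrite permM tpermL.
have ty : t y = s x by rewrite permM tpermR.
have tw w : w != x -> w != y -> t w = s w.
  by move=> wx wy; rewrite permM tpermD // eq_sym.
have st : porbit s z \subset porbit t z.
  suff : porbit s z \subset porbit t z :\ y by rewrite subsetD1 => /andP[].
  apply: porbit_min => [|w]; rewrite !inE ?porbit_id ?zy// => /andP[wy wz].
  have -> : s w != y by rewrite -sy (inj_eq perm_inj).
  have [wx|wx] := eqVneq w x; last by rewrite -(tw w)// porbit_closed.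
  by rewrite wx -ty -tx -wx !porbit_closed.
case: ifPn => xz; apply/eqP; rewrite eqEsubset ?st ?andbT.
  apply/andP; split; last by rewrite subUset sub1set -{1}tx porbit_closed// (subsetP st).
  apply: porbit_min => [|w]; rewrite !inE ?porbit_id ?orbT//.
  have [->|wy /= wz] := eqVneq w y; first by rewrite ty porbit_closed ?orbT.
  have [->|wx] := eqVneq w x; first by rewrite tx eqxx.
  by rewrite tw// porbit_closed// orbT.
apply: porbit_min => [|w wz]; first exact: porbit_id.
rewrite tw ?porbit_closed//; first by apply: contraNneq xz => <-.
by apply: contraNneq (porbit_fix s y z sy zy) => <-.
Qed.

Lemma card_porbit1 s x : (#|porbit s x| == 1%N) = (s x == x).
Proof.
apply/idP/eqP => [/cards1P[w e]|sx].
  have := porbit_closed s x x (porbit_id s x); have := porbit_id s x.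
  by rewrite e !inE => /eqP -> /eqP.
have : porbit s x \subset [set x].
  by apply: porbit_min => [|w]; rewrite !inE// => /eqP ->; rewrite sx.
by move=> /subset_leq_card; rewrite cards1 eqn_leq => ->; rewrite lt0n card_porbit_neq0.
Qed.

Lemma perm_on_fix A s y : perm_on (A :\ y) s = perm_on A s && (s y == y).
Proof.
apply/idP/andP => [sA|[sA /eqP sy]].
  split; first by apply: (subset_trans sA); exact: subsetDl.
  by rewrite (out_perm sA)// !inE eqxx.
apply/subsetP => w; rewrite !inE => sw; apply/andP; split.
  by apply: contraNneq sw => ->; rewrite sy.
by move/subsetP: sA; apply; rewrite inE.
Qed.

Context (m : nat).

Definition short_perms A : {set {perm T}} :=
  [set s | perm_on A s & [forall z, #|porbit s z| <= m]].

(** The cycle of x is exempt from the bound m, as its length j is prescribed: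
    this lets the cycle grow one point at a time. *)
Definition cycle_perms A x j : {set {perm T}} :=
  [set s | [&& perm_on A s, #|porbit s x| == j &
    [forall z, (z \in porbit s x) || (#|porbit s z| <= m)]]].

Lemma card_short_perms A x :
  #|short_perms A| = (\sum_(j < m) #|cycle_perms A x j.+1|)%N.
Proof.
under eq_bigr do rewrite -sum1_card big_mkcond /=.
rewrite -sum1_card big_mkcond exchange_big /=; apply: eq_bigr => s _.
rewrite -big_mkcond /= sum1_card.
case: ifPn => [|sS].
  rewrite inE => /andP[sA /forallP sm].
  have o0 : (0 < #|porbit s x|)%N by rewrite lt0n card_porbit_neq0.
  have om : (#|porbit s x|.-1 < m)%N by rewrite prednK.
  suff sE (j : 'I_m) : (s \in cycle_perms A x j.+1) = (j == Ordinal om).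
    by rewrite (eq_card1 (x := Ordinal om)).
  rewrite !inE sA/=.
  have -> : [forall z, (z \in porbit s x) || (#|porbit s z| <= m)].
    by apply/forallP => z; rewrite sm orbT.
  by rewrite andbT -val_eqE/= -(prednK o0) eqSS eq_sym.
suff sE (j : 'I_m) : (s \in cycle_perms A x j.+1) = false by rewrite eq_card0.
apply: contraNF sS; rewrite !inE.
move=> /and3P[-> /eqP sj /forallP sm]; apply/forallP => z.
have := sm z; rewrite -eq_porbit_mem; case: eqP => //= ->.
by rewrite sj ltn_ord.
Qed.

(** A cycle of length 1 is a fixed point, so x can be deleted from the
    support. *)
Lemma cycle_perms1 A x : (0 < m)%N -> cycle_perms A x 1 = short_perms (A :\ x).
Proof.
move=> m0; apply/setP => s; rewrite !inE perm_on_fix -andbA card_porbit1.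
case: (perm_on A s) => //=; case: eqP => //= sx; apply: eq_forallb => z.
have [zx|//] := boolP (z \in _).
have -> : porbit s z = porbit s x by apply/eqP; rewrite eq_porbit_mem.
by move/eqP: sx; rewrite -card_porbit1 => /eqP ->.
Qed.

(** Inserting y into the cycle of x lengthens that cycle by one; as y was
    itself a short cycle, the condition on the other cycles is unaffected. *)
Lemma cycle_perms_insert A x y j s : (0 < m)%N ->
  x \in A -> y \in A -> x != y -> s y = y ->
  ((tperm x y * s)%g \in cycle_perms A x j.+1) = (s \in cycle_perms (A :\ y) x j).
Proof.
move=> m0 xA yA xy sy; rewrite !inE perm_on_fix sy eqxx andbT.
have tA : perm_on A (tperm x y).
  apply/subsetP => w; rewrite inE; apply: contraR => wA.
  by rewrite tpermD//; apply: contraNneq wA => <-.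
have -> : perm_on A (tperm x y * s)%g = perm_on A s.
  apply/idP/idP => sA; last exact: perm_onM.
  by rewrite -[s]mul1g -[1%g](tperm2 x y) -mulgA perm_onM.
rewrite porbit_insert// porbit_id cardsU1 porbit_fix// add1n eqSS.
congr [&& _, _ & _]; apply: eq_forallb => z; rewrite in_setU1.
have [->/=|zy/=] := eqVneq z y.
  by move/eqP: sy; rewrite -card_porbit1 => /eqP ->; rewrite m0 orbT.
by rewrite porbit_insert// porbit_sym; case: ifP.
Qed.

(** Sorting by the point y that follows x, one deletes y from the cycle: this
    is the bijection of the previous lemma. *)
Lemma card_cycle_permsS A x j : (0 < m)%N -> x \in A ->
  #|cycle_perms A x j.+2| = (\sum_(y in A :\ x) #|cycle_perms (A :\ y) x j.+1|)%N.
Proof.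
move=> m0 xA; rewrite -sum1_card.
rewrite (partition_big (fun s => s x) (mem (A :\ x))) /= => [|s]; last first.
  rewrite !inE => /and3P[sA sj _]; rewrite (perm_closed _ sA) xA andbT.
  by rewrite -card_porbit1 (eqP sj).
apply: eq_bigr => y; rewrite !inE eq_sym => /andP[xy yA].
rewrite sum1dep_card -[RHS](card_imset _ (mulgI (tperm x y))).
congr #|pred_of_set _|; apply/setP => s; apply/idP/imsetP => [|[s' + ->]].
  rewrite inE => /andP[]; rewrite -{1}(mulKg (tperm x y) s) tpermV.
  move=> sC /eqP sx; exists (tperm x y * s)%g; last by rewrite mulgA tperm2 mul1g.
  by rewrite -cycle_perms_insert// permM tpermR.
move=> sC; have sy : s' y = y by move: sC; rewrite inE perm_on_fix => /andP[/andP[_ /eqP]].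
by rewrite inE cycle_perms_insert// sC permM tpermL sy eqxx.
Qed.

(** With k points in A, there are k - 1 choices of the point after x in the
    cycle, then k - 2 choices of the next one, and so on: these multiply to
    the falling factorial. The function g counts the permutations with short
    cycles of the points off the cycle; the bound N makes the hypothesis on g
    available as an induction hypothesis. *)
Lemma card_cycle_perms (g : nat -> nat) N A x j : (0 < m)%N ->
  (forall B, #|B| < N -> #|short_perms B| = g #|B|)%N ->
  x \in A -> (#|A| <= N)%N ->
  #|cycle_perms A x j.+1| = (#|A|.-1 ^_ j * g (#|A|.-1 - j))%N.
Proof.
move=> m0 gE; elim: j A => [|j IH] A xA AN.
  have Ax : #|A| = #|A :\ x|.+1 by rewrite (cardsD1 x A) xA.
  by rewrite cycle_perms1// ffactn0 mul1n Ax subn0 gE// -Ax.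
rewrite card_cycle_permsS//.
have AE y : y \in A -> #|A :\ y| = #|A|.-1 by move=> yA; rewrite (cardsD1 y A) yA.
rewrite (eq_bigr (fun=> #|A|.-2 ^_ j * g (#|A|.-2 - j)))%N => [|y]; last first.
  rewrite inE => /andP[]; rewrite inE eq_sym => xy yA.
  by rewrite IH ?AE// ?inE ?xy// (leq_trans (leq_pred _)).
by rewrite sum_nat_const AE// ffactnS mulnA subnS predn_sub.
Qed.

End Cycles.

Lemma card_short_perms_rec (m N : nat) (T : finType) (A : {set T}) (g : nat -> nat) :
  (0 < m)%N -> #|A| = N.+1 ->
  (forall B : {set T}, #|B| <= N -> #|short_perms T m B| = g #|B|)%N ->
  #|short_perms T m A| = (\sum_(j < m) N ^_ j * g (N - j))%N.
Proof.
move=> m0 AN gE; have /card_gt0P[x xA] : (0 < #|A|)%N by rewrite AN.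
rewrite (card_short_perms _ _ _ x); apply: eq_bigr => j _.
by rewrite (card_cycle_perms _ _ g N.+1) ?AN.
Qed.

(** Both sides obey the recurrence above, so the count depends on the number of
    points only, and no permutation need be transported along a bijection. *)
Lemma card_short_perms_ord (m : nat) (T : finType) (A : {set T}) : (0 < m)%N ->
  #|short_perms T m A| = #|short_perms _ m [set: 'I_#|A|]|.
Proof.
move=> m0; have [n] := ubnP #|A|; elim: n T A => // n IH T A An.
case AN: #|A| => [|N].
  have s1 (T' : finType) (B : {set T'}) : #|B| = 0%N -> #|short_perms T' m B| = 1%N.
    move=> /eqP; rewrite cards_eq0 => /eqP ->; apply/eqP/cards1P; exists 1%g.
    apply/setP => s; rewrite !inE; apply/andP/eqP => [[sB _]|->].
      by apply: (perm_on_id sB); rewrite cards0.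
    split; first exact: perm_on1.
    apply/forallP => z; rewrite (_ : #|_| = 1)%N//.
    by apply/eqP; rewrite card_porbit1 perm1.
  by rewrite !s1// cardsT card_ord.
have NIn : (N < n)%N by rewrite -ltnS -AN.
rewrite !(card_short_perms_rec m N _ _ (fun k => #|short_perms _ m [set: 'I_k]|))//.
- by rewrite cardsT card_ord.
- by move=> B BN; apply: IH; exact: leq_ltn_trans NIn.
- by move=> B BN; apply: IH; exact: leq_ltn_trans NIn.
Qed.

(** * An antiderivative of the Dickman function *)

Local Open Scope classical_set_scope.
Local Open Scope ring_scope.

(** Extending f to an even function makes it continuous on the whole line, so
    that the fundamental theorem of calculus applies at 0 too. *)
Lemma continuous_antiderivative (R : realType) (f : R -> R) :
  {within `[0, +oo[, continuous f} ->
  exists G : R -> R, forall x : R, 0 <= x -> is_derive x 1 G (f x).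
Proof.
move=> /subspace_continuousP cf.
have cg : continuous (fun x : R => f `|x|).
  move=> x B fB.
  have : nbhs (`|x| : R) [set y : R | 0 <= y -> B (f y)].
    have := cf `|x|; rewrite /= in_itv/= normr_ge0 => /(_ isT _ fB) fBx.
    have {}fBx : {near nbhs (`|x| : R), `[0, +oo[ `<=` f @^-1` B} := fBx.
    apply: (@filterS _ (nbhs (`|x| : R)) _ _ _ _ fBx) => y /= fy y0.
    by apply: fy; rewrite in_itv/= y0.
  move=> /(@norm_continuous _ R x) fBx.
  by apply: (@filterS _ (nbhs x) _ _ _ _ fBx) => y /=; apply; exact: normr_ge0.
(* Starting the integral at -1 makes 0 an interior point, where f o |.| is
   continuous, so that the derivative at 0 is two-sided. *)
exists (fun x => \int[lebesgue_measure]_(t in `[-1, x]) f `|t|)%R => x x0.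
have ig : lebesgue_measure.-integrable `[-1, x + 1] (EFin \o (fun t => f `|t|)).
  by apply: continuous_compact_integrable;
    [exact: segment_compact|exact: continuous_subspaceT].
have x1 : x < x + 1 by rewrite ltrDl.
have [] := continuous_FTC1 x1 ig _ (cg x); first by rewrite lte_fin; lra.
rewrite ger0_norm// => dG eG; apply: DeriveDef => //.
by rewrite -derive1E.
Qed.

Section Dickman.
Context (R : realType) (rho : R -> R) (Hrho : is_dickman rho).

Let rho1 (u : R) : 0 <= u <= 1 -> rho u = 1.
Proof. by case: Hrho => _ + _; apply. Qed.

Let within_rho (a b : R) : 0 <= a -> {within `[a, b], continuous rho}.
Proof.
move=> a0; case: Hrho => + _ _; apply: continuous_subspaceW => x /=.
by rewrite !in_itv/= andbT => /andP[/(le_trans a0)].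
Qed.

Lemma dickman_is_derive (u : R) : 1 < u -> is_derive u 1 rho (- rho (u - 1) / u).
Proof.
move=> u1; have [_ _ /(_ _ u1)[du eu]] := Hrho.
apply: DeriveDef => //; rewrite -eu derive1E mulrAC mulfV ?mul1r//.
by rewrite gt_eqF// (lt_trans _ u1).
Qed.

Context (G : R -> R) (dG : forall x : R, 0 <= x -> is_derive x 1 G (rho x)).

Let within_G (a b : R) : 0 <= a -> {within `[a, b], continuous G}.
Proof.
move=> a0; apply: derivable_within_continuous => x.
by rewrite in_itv/= => /andP[ax _]; have [] := dG _ (le_trans a0 ax).
Qed.

Lemma antiderivative_mean (a b : R) : 0 <= a <= b ->
  exists2 c, a <= c <= b & G b - G a = rho c * (b - a).
Proof.
move=> /andP[a0 ab].
have [x|c + ->] := @MVT_segment R G rho a b ab _ (@within_G a b a0); last first.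
  by rewrite in_itv/=; exists c.
by rewrite in_itv/= => /andP[ax _]; apply/dG/(le_trans a0)/ltW.
Qed.

(** The difference H of the two sides is continuous on [1, u] with derivative
    (rho(u) + u rho'(u)) - rho(u) + rho(u - 1) = 0, and vanishes at 1. *)
Lemma dickman_integral (u : R) : 1 <= u -> u * rho u = G u - G (u - 1).
Proof.
move=> u1; pose H (x : R) : R := x * rho x - G x + G (x - 1).
suff : H u = H 1.
  rewrite /H (rho1 1); last lra.
  have [|c c01] := antiderivative_mean 0 1; first lra.
  by rewrite subrr (rho1 c)//; lra.
have dH (x : R) : 1 < x -> is_derive x 1 H 0.
  move=> x1; have drho := dickman_is_derive _ x1.
  have dGx : is_derive x 1 G (rho x) by apply: dG; lra.
  have dGx1 : is_derive (x - 1) 1 G (rho (x - 1)) by apply: dG; lra.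
  rewrite /H; apply: is_derive_eq.
  rewrite /GRing.scale/=; field; lra.
have [x||c _] := @MVT_segment R H (fun=> 0) 1 u u1.
- by rewrite in_itv/= => /andP[x1 _]; exact: dH.
- move=> x; apply: cvgD; first apply: cvgB; first apply: cvgM.
  + have cid : {within `[1, u], continuous (id : R -> R)}.
      by apply: continuous_subspaceT => y; exact: cvg_id.
    exact: cid.
  + exact: within_rho.
  + exact: within_G.
  + apply: (@derivable_within_continuous _ _ (fun y : R => G (y - 1)) `[1, u]) => y.
    rewrite in_itv/= => /andP[y1 _].
    have dGy : is_derive (y - 1) 1 G (rho (y - 1)) by apply: dG; lra.
    exact: ex_derive.
- by rewrite mul0r => /subr0_eq.
Qed.

(** * Monotonicity and Riemann sums *)

(** By induction on unit intervals. As rho >= 0 on [0, k + 1], the equation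
    gives rho' <= 0 up to k + 2, so rho is nonincreasing there. Then
    u rho(u) = int_(u - 1)^u rho >= rho(u) for u in that range, i.e.
    (u - 1) rho(u) >= 0, so rho is still nonnegative. *)
Lemma dickman_ge0_le (k : nat) :
  (forall x : R, 0 <= x <= k.+1%:R -> 0 <= rho x) /\
  (forall x y : R, 0 <= x -> x <= y -> y <= k.+1%:R -> rho y <= rho x).
Proof.
elim: k => [|k [IH0 _]].
  by split=> [x|x y] *; rewrite !rho1//; lra.
have le (x y : R) : 0 <= x -> x <= y -> y <= k.+2%:R -> rho y <= rho x.
  move=> x0 xy yk.
  have [y1|y1] := leP y 1; first by rewrite !rho1//; lra.
  (* rho is constant on [0, 1], so x may be moved to 1, past the corner. *)
  wlog x1 : x x0 xy / 1 <= x.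
    move=> le1; have [x1|/ltW x1] := leP 1 x; first exact: le1.
    by rewrite (rho1 x) ?x0// -(rho1 1) ?ler01 ?lexx//; apply: le1 => //; exact: ltW.
  have [z||] := @MVT_segment R rho (fun u => - rho (u - 1) / u) x y xy.
  - rewrite in_itv/= => /andP[xz _]; apply: dickman_is_derive; lra.
  - exact: within_rho.
  - move=> z; rewrite in_itv/= => /andP[xz zy] e; rewrite -subr_le0 e.
    rewrite mulr_le0_ge0 ?subr_ge0// mulNr oppr_le0 divr_ge0//; last lra.
    by apply: IH0; rewrite subr_ge0 (le_trans x1)//= lerBlDr natr1 (le_trans zy).
split=> // u /andP[u0 uk].
have [u1|u1] := leP u 1; first by rewrite rho1 ?u0.
have [|c /andP[c0 cu]] := antiderivative_mean (u - 1) u; first lra.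
rewrite -dickman_integral ?(ltW u1)// subKr mulr1 => e.
have : rho u <= rho c by apply: le => //; lra.
by rewrite -e; nra.
Qed.

Lemma dickman_nonincreasing (x y : R) : 0 <= x -> x <= y -> rho y <= rho x.
Proof.
move=> x0 xy; have [_ le] := dickman_ge0_le (Num.truncn y).
by apply: le => //; apply/ltW/truncnS_gt.
Qed.

(** The integral over each step is the length h times a value of rho inside
    the step, hence lies between the products of h with the endpoint values. *)
Lemma antiderivative_sum (h b : R) (k : nat) : 0 <= h -> 0 <= b - k%:R * h ->
  \sum_(j < k) rho (b - j%:R * h) * h <= G b - G (b - k%:R * h)
    <= \sum_(j < k) rho (b - j.+1%:R * h) * h.
Proof.
move=> h0; elim: k => [|k IH] bk.
  by rewrite !big_ord0 mul0r subr0 subrr lexx.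
have bk' : b - k.+1%:R * h <= b - k%:R * h by rewrite -natr1; lra.
have /andP[IH1 IH2] := IH (le_trans bk bk').
rewrite !big_ord_recr/=.
have [|c /andP[bc cb]] := antiderivative_mean (b - k.+1%:R * h) (b - k%:R * h).
  by rewrite bk.
have -> : b - k%:R * h - (b - k.+1%:R * h) = h by rewrite -natr1; ring.
move=> e.
have l1 : rho (b - k%:R * h) * h <= rho c * h.
  by rewrite ler_wpM2r// dickman_nonincreasing// (le_trans bk).
have l2 : rho c * h <= rho (b - k.+1%:R * h) * h.
  by rewrite ler_wpM2r// dickman_nonincreasing.
by apply/andP; split; lra.
Qed.

End Dickman.

Lemma dickman_sum (R : realType) (rho : R -> R) (Hrho : is_dickman rho) (m : nat) (u : R) :
  (0 < m)%N -> 1 <= u ->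
  \sum_(j < m) rho (u - j%:R / m%:R) <= m%:R * (u * rho u)
    <= \sum_(j < m) rho (u - j.+1%:R / m%:R).
Proof.
move=> m0 u1; have [+ _ _] := Hrho => /continuous_antiderivative[G dG].
have mR : m%:R != 0 :> R by rewrite pnatr_eq0 -lt0n.
have mR0 : 0 < m%:R :> R by rewrite ltr0n.
have := antiderivative_sum _ _ Hrho _ dG m%:R^-1 u m.
rewrite invr_ge0 ler0n mulfV// subr_ge0 -dickman_integral// => /(_ isT u1).
by rewrite -!mulr_suml !ler_pdivrMr ?ler_pdivlMr// mulrC.
Qed.

(** * The two bounds *)

Lemma perms_cycles_leE (n m : nat) :
  perms_cycles_le n m = short_perms _ m [set: 'I_n]%SET.
Proof.
apply/setP => s; rewrite !inE.
have -> : perm_on [set: 'I_n]%SET s by apply/subsetP => x _; rewrite inE.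
apply/forall_inP/forallP => [sm z|sm _ /imsetP[z _ ->] //].
by apply: sm; exact: imset_f.
Qed.

Lemma nu_recurrence (R : realType) (n m : nat) : (0 < m)%N -> (m <= n.+1)%N ->
  n.+1%:R * nu R n.+1 m = \sum_(j < m) nu R (n - j) m.
Proof.
move=> m0 mn; rewrite /nu card_Sn factS natrM invfM mulrCA mulVKf ?pnatr_eq0//.
rewrite perms_cycles_leE (card_short_perms_rec m n _ _
  (fun k => #|perms_cycles_le k m|))//; last first.
- by move=> B _; rewrite perms_cycles_leE; exact: card_short_perms_ord.
- by rewrite cardsT card_ord.
rewrite natr_sum mulr_suml; apply: eq_bigr => j _.
have jn : (j <= n)%N by rewrite -ltnS (leq_trans (ltn_ord j)).
rewrite card_Sn -(ffact_fact jn) !natrM invfM mulrACA mulfV ?mul1r//.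
by rewrite pnatr_eq0 -lt0n ffact_gt0.
Qed.

Lemma nu_eq1 (R : realType) (n m : nat) : (n <= m)%N -> nu R n m = 1.
Proof.
move=> nm; rewrite /nu perms_cycles_leE.
have -> : short_perms _ m [set: 'I_n]%SET = [set: {perm 'I_n}]%SET.
  apply/setP => s; rewrite !inE; apply/andP; split.
    by apply/subsetP => x _; rewrite inE.
  apply/forallP => z; apply: leq_trans nm.
  by rewrite -[leqRHS]card_ord max_card.
by rewrite cardsT mulfV// pnatr_eq0 card_Sn -lt0n fact_gt0.
Qed.

Lemma dickman_le_nu (R : realType) (rho : R -> R) (Hrho : is_dickman rho) (n m : nat) :
  (0 < m)%N -> rho (n%:R / m%:R) <= nu R n m.
Proof.
move=> m0; have mR : 0 < m%:R :> R by rewrite ltr0n.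
elim/ltn_ind: n => n IH; have [nm|] := leqP n m.
  rewrite nu_eq1//; case: Hrho => _ -> //.
  by rewrite divr_ge0 ?ler0n//= ler_pdivrMr// mul1r ler_nat.
case: n IH => // n IH mn.
rewrite -(ler_pM2l (ltr0Sn R n)) nu_recurrence//; last exact: ltnW.
have u1 : 1 <= n.+1%:R / m%:R :> R by rewrite ler_pdivlMr// mul1r ler_nat ltnW.
have /andP[_] := dickman_sum _ _ Hrho _ _ m0 u1.
rewrite mulrA mulrCA mulfV ?mulr1 ?gt_eqF// => /le_trans; apply.
apply: ler_sum => j _; have jn : (j <= n)%N by rewrite -ltnS (ltn_trans (ltn_ord j)).
by rewrite -mulrBl -natrB ?ltnS// subSS IH// ltnS leq_subr.
Qed.

Lemma nu_le_dickman (R : realType) (rho : R -> R) (Hrho : is_dickman rho) (n m : nat) :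
  (0 < m)%N -> nu R n m <= rho (n.+1%:R / m.+1%:R).
Proof.
move=> m0; elim/ltn_ind: n => n IH; have [nm|] := leqP n m.
  rewrite nu_eq1//; case: Hrho => _ -> //.
  by rewrite divr_ge0 ?ler0n//= ler_pdivrMr// mul1r ler_nat.
case: n IH => // n IH mn.
rewrite -(ler_pM2l (ltr0Sn R n)) nu_recurrence//; last exact: ltnW.
pose u : R := n.+2%:R / m.+1%:R; rewrite -/u.
have u1 : 1 <= u by rewrite ler_pdivlMr// mul1r ler_nat ltnW.
have mu : m.+1%:R * u = n.+1%:R + 1 by rewrite mulrCA mulfV ?mulr1 ?natr1 ?pnatr_eq0.
have /andP[+ _] := dickman_sum _ _ Hrho _ _ (ltn0Sn m) u1.
rewrite mulrA mu mulrDl mul1r big_ord_recl mul0r subr0 -lerBrDl addrK.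
move=> /(le_trans _); apply.
apply: ler_sum => j _; have jn : (j <= n)%N by rewrite -ltnS (ltn_trans (ltn_ord j)).
rewrite lift0 -mulrBl -natrB; last by rewrite ltnS ltnW.
by rewrite subSS subSn// IH// ltnS leq_subr.
Qed.

Theorem theorem1p17 (R : realType) (rho : R -> R) (Hrho : is_dickman rho)
    (n m : nat) (Hm : (1 <= m)%N) (Hmn : (m <= n)%N) :
  rho (n%:R / m%:R) <= nu R n m <= rho (n.+1%:R / m.+1%:R).
Proof. by rewrite dickman_le_nu// nu_le_dickman. Qed.
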